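(* Let $(\phi_t)$ be a non-elliptic semigroup in $\mathbb{D}$. Let $(\Omega,h,\psi_t)$ be a canonical model for $(\phi_t)$ and let $\tilde h:\mathbb{D}\to\Omega$ be holomorphic. Then: (1) If $(\phi_t)$ is either hyperbolic or parabolic of positive hyperbolic step, then $\tilde h$ is a Königs function for $(\phi_t)$ if and only if there exists $a\in\mathbb{R}$ such that $\tilde h(z)=h(z)+ai$ for all $z\in\mathbb{D}$. (2) If $(\phi_t)$ is parabolic of zero hyperbolic step, then $\tilde h$ is a Königs function for $(\phi_t)$ if and only if there exists $a\in\mathbb{C}$ such that $\tilde h(z)=h(z)+a$ for all $z\in\mathbb{D}$.
   Context: $\mathbb{D}=\{z\in\mathbb{C}:|z|<1\}$, $\mathbb{H}=\{\operatorname{Re}\zeta>0\}$, $\mathbb{H}^-=\{\operatorname{Re}\zeta<0\}$, and for $\rho>0$, $\mathbb{S}_\rho=\{0<\operatorname{Re}\zeta<\rho\}$. A semigroup $(\phi_t)$ in $\mathbb{D}$ is a continuous homomorphism $t\mapsto\phi_t$ from the additive semigroup $[0,+\infty)$ to the semigroup (under composition) of holomorphic self-maps of $\mathbb{D}$ with the topology of uniform convergence on compacta. It is elliptic if there is $x\in\mathbb{D}$ with $\phi_t(x)=x$ for all $t\ge0$. If it is not elliptic, there is a unique point $\tau\in\partial\mathbb{D}$ (the Denjoy-Wolff point) for which there exists $\lambda\ge0$ (the spectral value) with $\liminf_{z\to\tau}\frac{1-|\phi_t(z)|}{1-|z|}=e^{-\lambda t}$ for all $t\ge0$; a non-elliptic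 semigroup is hyperbolic if $\lambda>0$ and parabolic if $\lambda=0$. Let $\omega$ be the hyperbolic distance of $\mathbb{D}$. For $u\ge0$ and $z\in\mathbb{D}$, $s_u(\phi_t,z):=\lim_{r\to+\infty}\omega(\phi_r(z),\phi_{r+u}(z))$. The semigroup is of positive hyperbolic step if there exist $z\in\mathbb{D}$, $u\ge0$ with $s_u(\phi_t,z)>0$; otherwise it is of zero hyperbolic step. A holomorphic model for $(\phi_t)$ is a triple $(\Omega,h,\psi_t)$ where $\Omega$ is a Riemann surface, $h:\mathbb{D}\to\Omega$ is univalent (holomorphic and injective), and $(\psi_t)$ is a continuous group of automorphisms of $\Omega$ such that $h\circ\phi_t=\psi_t\circ h$ for all $t\ge0$ and $\bigcup_{t\ge0}\psi_{-t}(h(\mathbb{D}))=\Omega$. For a non-elliptic semigroup, a canonical model is a holomorphic model of the form $(\Omega,h,z\mapsto z+it)$, where $\Omega=\mathbb{S}_{\pi/\lambda}$ if $(\phi_t)$ is hyperbolic with spectral value $\lambda$, $\Omega\in\{\mathbb{H},\mathbb{H}^-\}$ if $(\phi_t)$ is parabolic of positive hyperbolic step, and $\Omega=\mathbb{C}$ if $(\phi_t)$ is parabolic of zero hyperbolic step. Every non-elliptic semigroup has a canonical model, and the base space $\Omega$ is determined by the semigroup. The map $h$ of a canonical model is called a Königs function of $(\phi_t)$. *)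

(* Defs.v *)
From HB Require Import structures.
From mathcomp Require Import all_boot all_order all_algebra.
From mathcomp Require Import all_classical all_reals all_analysis.
From mathcomp Require Export complex.
Set Implicit Arguments.
Unset Strict Implicit.
Unset Printing Implicit Defensive.
Import Order.TTheory GRing.Theory Num.Theory.
Import numFieldNormedType.Exports.

Local Open Scope classical_set_scope.
Local Open Scope ring_scope.
Local Open Scope complex_scope.

(* MathComp-Analysis puts the norm topology on K^o for any numFieldType K; it is
   transported here to R[i] itself, so that [derivable f z 1] is complex
   differentiability. *)
#[non_forgetful_inheritance]
HB.instance Definition _ (R : rcfType) := NormedModule.copy R[i] R[i]^o.

(* Real-valued modulus: the generic norm of R[i] takes its values in R[i]. *)
Notation normc := ComplexField.Normc.normc.

Section PlaneDomains.
Context {R : realType}.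
Implicit Types (U : set R[i]) (f : R[i] -> R[i]).

Definition disc : set R[i] := [set z | normc z < 1].
Definition right_half_plane : set R[i] := [set z | 0 < complex.Re z].
Definition left_half_plane : set R[i] := [set z | complex.Re z < 0].
Definition strip (rho : R) : set R[i] :=
  [set z | 0 < complex.Re z < rho].

Definition holomorphic_on U f := forall z, U z -> derivable f z 1.

Definition univalent_on U f := holomorphic_on U f /\ set_inj U f.

Definition automorphism_of U f :=
  [/\ holomorphic_on U f, set_fun U U f &
      exists g, [/\ holomorphic_on U g, set_fun U U g,
                    forall z, U z -> g (f z) = z &
                    forall z, U z -> f (g z) = z]].

Definition compact_subsets U : set (set R[i]) :=
  [set K | compact K /\ K `<=` U].

(* The hyperbolic distance of the disc, for the metric |dz| / (1 - |z|^2). *)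
Definition hyperbolic_dist (z w : R[i]) : R :=
  let r := normc ((z - w) / (1 - w^* * z)) in
  2^-1 * ln ((1 + r) / (1 - r)).

End PlaneDomains.

(* Maps of a plane domain into the plane are total functions on R[i] whose
   values off the domain are irrelevant; likewise a semigroup is indexed by R
   and its values at negative times are irrelevant. *)
Section Semigroups.
Context {R : realType}.
Implicit Types (phi psi : R -> R[i] -> R[i]) (h : R[i] -> R[i]).

Definition semigroup phi :=
  [/\ forall t, 0 <= t -> holomorphic_on disc (phi t) /\ set_fun disc disc (phi t),
      forall z, disc z -> phi 0 z = z,
      forall s t z, 0 <= s -> 0 <= t -> disc z ->
        phi (s + t) z = phi s (phi t z) &
      {within `[0, +oo[, continuous
        (phi : R -> {family compact_subsets disc, R[i] -> R[i]})}].

Definition elliptic phi :=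
  exists x, disc x /\ forall t, 0 <= t -> phi t x = x.

(* For a non-elliptic semigroup there is exactly one such pair (tau, lambda):
   the Denjoy-Wolff point and the spectral value. The disc does not contain tau,
   so z is automatically distinct from tau in the lower limit. *)
Definition denjoy_wolff phi (tau : R[i]) (lambda : R) :=
  [/\ normc tau = 1, 0 <= lambda &
      forall t, 0 <= t ->
        limf_einf (fun z => ((1 - normc (phi t z)) / (1 - normc z))%:E)
                  (within disc (nbhs tau))
        = (expR (- (lambda * t)))%:E].

Definition spectral_value phi (lambda : R) :=
  exists tau, denjoy_wolff phi tau lambda.

Definition hyperbolic phi :=
  ~ elliptic phi /\ exists2 lambda, 0 < lambda & spectral_value phi lambda.

Definition parabolic phi := ~ elliptic phi /\ spectral_value phi 0.

Definition hyperbolic_step phi (u : R) (z : R[i]) : R :=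
  lim (hyperbolic_dist (phi r z) (phi (r + u) z) @[r --> +oo]).

Definition positive_hyperbolic_step phi :=
  exists z u, [/\ disc z, 0 <= u & 0 < hyperbolic_step phi u z].

Definition zero_hyperbolic_step phi := ~ positive_hyperbolic_step phi.

Definition automorphism_group (Omega : set R[i]) psi :=
  [/\ forall t, automorphism_of Omega (psi t),
      forall z, Omega z -> psi 0 z = z,
      forall s t z, Omega z -> psi (s + t) z = psi s (psi t z) &
      continuous
        (psi : R -> {family compact_subsets Omega, R[i] -> R[i]})].

(* Base spaces are restricted to plane domains, which are the only ones that
   occur in canonical models. *)
Definition holomorphic_model phi (Omega : set R[i]) h psi :=
  [/\ open Omega /\ connected Omega,
      univalent_on disc h /\ set_fun disc Omega h,
      automorphism_group Omega psi,
      forall t z, 0 <= t -> disc z -> h (phi t z) = psi t (h z) &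
      \bigcup_(t in `[0, +oo[) (psi (- t) @` (h @` disc)) = Omega].

Definition canonical_model phi (Omega : set R[i]) h psi :=
  [/\ holomorphic_model phi Omega h psi,
      forall t z, Omega z -> psi t z = z + t%:C * 'i%C,
      forall lambda, hyperbolic phi -> spectral_value phi lambda ->
        Omega = strip (pi / lambda),
      parabolic phi -> positive_hyperbolic_step phi ->
        Omega = right_half_plane \/ Omega = left_half_plane &
      parabolic phi -> zero_hyperbolic_step phi -> Omega = setT].

Definition koenigs_function phi h :=
  exists Omega psi, canonical_model phi Omega h psi.

End Semigroups.

(* Main.v *)
Require Import Defs.
From mathcomp Require Import all_boot all_order all_algebra.
From mathcomp Require Import all_classical all_reals all_analysis.
From mathcomp Require Import ring lra.
Import Order.TTheory GRing.Theory Num.Theory.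
Import numFieldNormedType.Exports.
Local Open Scope classical_set_scope.
Local Open Scope ring_scope.
Local Open Scope complex_scope.

(** The map h of a canonical model linearizes the semigroup:
[h (phi t z) = h z + t * i]. Two holomorphic solutions f and g of this equation
differ by a constant. Indeed, fix z in the disc; as t decreases to 0 the point
[phi t z] tends to z and stays different from z, because h moves it by [t * i].
Hence the derivative of f at z, and likewise that of g, is the limit of
[t * i / (phi t z - z)]. So [f' = g'] on the disc ([derive_eq_along]), and
[g - f] is constant on the segment from 0 to z ([derive0_segment]). This gives
[abel_equation_unique], hence [htilde = h + c] for any two Koenigs functions.

The base space is the union of the backward translates [h(D) - t * i]
([canonical_baseP]), so adding c to h translates it by c. In the hyperbolic case
both base spaces are the same strip, and in the parabolic case of positive step
the same half-plane, since htilde maps the disc into both; a strip or half-plane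
with vertical boundary that is invariant under c forces [Re c = 0]. Conversely,
adding a constant that preserves the base space, which is an imaginary one in
general and any one when the base space is the plane, yields another canonical
model with the same base space and the same group ([canonical_translate]). *)

(** * Complex derivatives along paths and segments *)

(** A path through z determines the complex derivative at z, since the limit of
the difference quotients may be taken along the path alone: the functions need
only have the same increments on it. *)
Lemma derive_eq_along {R : realType} {T : Type} {F : set_system T}
    {FF : ProperFilter F} {f g : R[i] -> R[i]} {gamma : T -> R[i]} {z : R[i]} :
  derivable f z 1 -> derivable g z 1 -> gamma @ F --> z ->
  (\forall t \near F, gamma t != z) ->
  (\forall t \near F, f (gamma t) - f z = g (gamma t) - g z) ->
  'D_1 f z = 'D_1 g z.
Proof.
move=> df dg gz gNz fg.
pose q (k : R[i] -> R[i]) (e : R[i]) : R[i] := e^-1 *: (k (e *: 1 + z) - k z).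
have g0 : (gamma t - z) @[t --> F] --> (0 : R[i])^'.
  move=> A /= [e e0 eA].
  suff : \forall t \near F, A (gamma t - z) by [].
  have : \forall t \near F, `|z - gamma t| < e by move/cvgrPdist_lt: gz; apply.
  move=> H; near=> t; apply: eA => /=.
    by rewrite sub0r normrN distrC; near: t.
  by rewrite subr_eq0; near: t.
have qf : q f (gamma t - z) @[t --> F] --> 'D_1 f z.
  have dq : q f e @[e --> (0 : R[i])^'] --> 'D_1 f z by exact: df.
  exact: (cvg_comp _ _ g0 dq).
have qg : q g (gamma t - z) @[t --> F] --> 'D_1 g z.
  exact: (cvg_comp _ _ g0 dg).
suff qfg : q f (gamma t - z) @[t --> F] --> 'D_1 g z.
  exact: (cvg_unique _ qf qfg).
apply: cvg_trans qg; apply: near_eq_cvg.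
near=> t; congr (_ *: _).
rewrite /GRing.scale /= mulr1 subrK; symmetry.
by near: t.
Unshelve. all: by end_near. Qed.

Lemma continuous_Re {R : realType} : continuous (@complex.Re R).
Proof.
move=> z; apply/(@cvgrPdist_lt _ _ _ (nbhs z) (nbhs_filter z)) => e e0.
have e0' : 0 < e%:C :> R[i] by rewrite ltcR.
near=> w.
rewrite -ltcR; apply: le_lt_trans (_ : `|z - w| < _).
  have -> : complex.Re z - complex.Re w = complex.Re (z - w).
    by case: (z) (w) => ? ? [? ?].
  exact: normc_ge_Re.
near: w.
exact: cvgr_dist_lt.
Unshelve. all: by end_near. Qed.

Lemma continuous_real_complex {R : realType} : continuous (real_complex R).
Proof.
move=> x; apply/(@cvgrPdist_lt _ _ _ (nbhs x) (nbhs_filter x)) => e e0.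
have [] : 0 < complex.Re e /\ complex.Im e = 0.
  by move: e0; rewrite ltcE /= => /andP[/eqP <-].
case: e {e0} => e ei /= e0 ->.
near=> y.
rewrite -raddfB normc_def /= expr0n /= addr0 sqrtr_sqr ltcR.
near: y.
exact: cvgr_dist_lt.
Unshelve. all: by end_near. Qed.

Lemma Re_real_mul {R : realType} (r : R) (w : R[i]) :
  complex.Re (r%:C * w) = r * complex.Re w.
Proof. by case: w => a b /=; rewrite mul0r subr0. Qed.

(** The mean value theorem fails for complex-valued functions, so it is applied
to the real function [Re (c * u)] along the segment, where the constant
[c = conj (u y - u x)] turns its total increment into [|u y - u x|^2]. *)
Lemma derive0_segment {R : realType} {u : R[i] -> R[i]} {x y : R[i]} :
  (forall s : R, 0 <= s <= 1 ->
     derivable u (x + s%:C * (y - x)) 1 /\ 'D_1 u (x + s%:C * (y - x)) = 0) ->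
  u x = u y.
Proof.
move=> Hu; apply/eqP; rewrite eq_sym -subr_eq0 -normr_eq0.
have [->|xy] := eqVneq y x; first by rewrite subrr normr0.
pose c := (u y - u x)^*.
pose p (s : R) := x + s%:C * (y - x).
pose F (s : R) := complex.Re (c * u (p s)).
have dF (s : R) : 0 <= s <= 1 -> is_derive s 1 F 0.
  move=> s01; have [du Du] := Hu s s01.
  have cv : (h^-1 *: (F (h *: 1 + s) - F s)) @[h --> (0 : R)^'] --> (0 : R).
    have ez : (e%:C * (y - x)) @[e --> (0 : R)^'] --> (0 : R[i])^'.
      have c0 : (e%:C * (y - x)) @[e --> (0 : R)^'] --> (0 : R[i]).
        rewrite -[X in _ --> X](mul0r (y - x)).
        apply: cvgM; last exact: cvg_cst.
        apply: cvg_trans (continuous_real_complex 0).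
        exact: cvg_app (cvg_within _).
      move=> A /= [e e0 eA].
      suff : \forall t \near (0 : R)^', A (t%:C * (y - x)) by [].
      have : \forall t \near (0 : R)^', `|0 - t%:C * (y - x)| < e.
        by move/cvgrPdist_lt: c0; apply.
      move=> H; near=> t; apply: eA => /=.
        by near: t.
      rewrite mulf_neq0 ?subr_eq0//.
      have : t != 0 by near: t; exact: nbhs_dnbhs_neq.
      by apply: contra => /eqP[->].
    have := cvg_comp _ _ ez du; rewrite -/(derive _ _ _) Du => qu.
    have {}qu : c * (y - x) * ((h%:C * (y - x))^-1 *
        (u (h%:C * (y - x) + p s) - u (p s))) @[h --> (0 : R)^'] --> (0 : R[i]).
      rewrite -[X in _ --> X](mulr0 (c * (y - x))).
      apply: cvgM; first exact: cvg_cst.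
      apply: cvg_trans qu; apply: near_eq_cvg; apply: nearW => h /=.
      by rewrite /GRing.scale /= mulr1.
    have {}qu := cvg_comp _ _ qu (@continuous_Re R 0).
    apply: cvg_trans qu; apply: near_eq_cvg.
    near=> t.
    have t0 : t != 0 by near: t; exact: nbhs_dnbhs_neq.
    have t0' : t%:C != 0 by apply: contra t0 => /eqP[->].
    rewrite /F /p /=.
    rewrite /GRing.scale /= mulr1 -raddfB /= -mulrBr -Re_real_mul.
    rewrite addrA [_ + x]addrC -addrA -mulrDl -raddfD /=; congr complex.Re.
    rewrite fmorphV /=; field.
    by apply/andP; split; [exact: t0' | rewrite subr_eq0].
  by apply: DeriveDef; [apply/cvg_ex; exists 0 | exact: cvg_lim cv].
have F01 : {within `[0, 1], continuous F}.
  apply: derivable_within_continuous => s; rewrite in_itv /= => s01.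
  by case: (dF s s01).
have dF' (s : R) : s \in `]0, 1[ -> is_derive s 1 F 0.
  by rewrite in_itv /= => /andP[s0 s1]; apply: dF; rewrite !ltW.
have [_ _] := MVT ltr01 dF' F01.
rewrite mul0r /F /p mul0r mul1r addr0 [x + _]addrC subrK -raddfB -mulrBr /=.
rewrite mulrC -sqr_normc normc_def -rmorphXn /= => /eqP.
by rewrite sqrf_eq0 => /eqP ->.
Unshelve. all: by end_near. Qed.

(** * Small times in a semigroup *)

Lemma semigroup_cvg0 {R : realType} {phi : R -> R[i] -> R[i]} {z : R[i]} :
  semigroup phi -> disc z -> phi t z @[t --> 0^'+] --> z.
Proof.
move=> [_ phi0 _ phic] Dz.
have z0 : `[0, +oo[%classic (0 : R) by rewrite /= in_itv /= lexx.
have : phi t @[t --> within `[0, +oo[ (nbhs (0 : R))] -->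
    (phi 0 : {family compact_subsets disc, R[i] -> R[i]}).
  have := phic 0; rewrite /continuous_at.
  by case: (nbhs_subspaceP `[(0:R), +oo[%classic 0).
move/fam_cvgP => /(_ [set z]).
rewrite uniform_set1 => H.
have {}H : phi t z @[t --> within `[0, +oo[ (nbhs (0:R))] --> phi 0 z.
  by apply: H; split; [exact: compact_set1|move=> _ ->].
rewrite phi0 // in H.
apply: cvg_trans H.
apply: cvg_app.
apply: within_subset.
by move=> t /=; rewrite in_itv /= andbT => /ltW.
Qed.

(** * Solutions of the Abel equation *)

Lemma disc_scale {R : realType} {s : R} {z : R[i]} :
  0 <= s <= 1 -> disc z -> disc (s%:C * z).
Proof.
rewrite /disc /= => /andP[s0 s1] z1.
rewrite -ltcR -[(normc _)%:C]/`|s%:C * z| normrM.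
rewrite normc_def /= expr0n /= addr0 sqrtr_sqr ger0_norm//.
rewrite -[`|z|]/((normc z)%:C) -rmorphM /= ltcR.
apply: le_lt_trans z1; rewrite ler_piMl//.
by case: (z) => a b; exact: sqrtr_ge0.
Qed.

Definition abel_equation {R : realType} (phi : R -> R[i] -> R[i])
    (h : R[i] -> R[i]) : Prop :=
  forall t z, 0 <= t -> disc z -> h (phi t z) = h z + t%:C * 'i%C.

(** Along a trajectory both solutions have the same increments, which are
nonzero for positive times, so that the trajectory leaves its starting point. Letting
the time tend to zero gives equal derivatives at every point of the disc. *)
Lemma abel_equation_unique {R : realType} {phi : R -> R[i] -> R[i]}
    {f g : R[i] -> R[i]} :
  semigroup phi -> holomorphic_on disc f -> holomorphic_on disc g ->
  abel_equation phi f -> abel_equation phi g ->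
  forall z, disc z -> g z = f z + (g 0 - f 0).
Proof.
move=> sg fh gh fA gA z Dz.
suff : (g - f) 0 = (g - f) z.
  move=> gf0; rewrite -[g z](subrK (f z)) addrC; congr (_ + _).
  exact: esym gf0.
apply: derive0_segment => s s01; rewrite add0r subr0.
set w := s%:C * z.
have Dw : disc w by exact: disc_scale.
split; first by apply: derivableB; [exact: gh|exact: fh].
rewrite deriveB; [|exact: gh|exact: fh].
apply/eqP; rewrite subr_eq0; apply/eqP.
(* Both derivatives at w are computed along the trajectory of w, on which both
   functions have the increments t * i. *)
apply: (@derive_eq_along _ _ (0 : R)^'+ _ _ _ (phi^~ w)).
- exact: gh.
- exact: fh.
- exact: semigroup_cvg0.
- near=> t; have t0 : 0 < t by near: t; exact: nbhs_right_gt.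
  apply/negP => /eqP pw; have := fA t w (ltW t0) Dw.
  rewrite pw => /eqP; rewrite -subr_eq0 opprD addrA subrr sub0r oppr_eq0.
  rewrite mulf_eq0 => /orP[/eqP[] tE|]; first by rewrite tE ltxx in t0.
  by rewrite eq_complex /= oner_eq0 andbF.
- near=> t; have t0 : 0 <= t by near: t; exact: nbhs_right_ge.
  by rewrite fA// gA// ![_ + t%:C * _]addrC !addrK.
Unshelve. all: by end_near. Qed.

(** * Base spaces of canonical models *)

Lemma canonical_abel {R : realType} {phi : R -> R[i] -> R[i]}
    {Omega : set R[i]} {h : R[i] -> R[i]} {psi : R -> R[i] -> R[i]} :
  canonical_model phi Omega h psi -> abel_equation phi h.
Proof.
move=> model t z t0 Dz; case: model => -[_ [_ hO] _ hA _] psiE _ _ _.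
by rewrite hA// psiE//; exact: hO.
Qed.

(** The model exhausts its base space by backward translates of the image
of the disc, so the base space can be recovered from h alone. *)
Lemma canonical_baseP {R : realType} {phi : R -> R[i] -> R[i]}
    {Omega : set R[i]} {h : R[i] -> R[i]} {psi : R -> R[i] -> R[i]} :
  canonical_model phi Omega h psi -> forall w,
  Omega w <-> exists t z, [/\ 0 <= t, disc z & w = h z - t%:C * 'i%C].
Proof.
move=> -[[_ [_ hO] _ _ OE] psiE _ _ _] w; rewrite -[X in X w]OE; split.
  move=> [t /=]; rewrite in_itv /= andbT => t0 [_ [z Dz <-] <-].
  exists t, z; split=> //.
  by rewrite psiE ?rmorphN ?mulNr//; exact: hO.
move=> [t [z [t0 Dz ->]]]; exists t; first by rewrite /= in_itv /= andbT.
exists (h z); first by exists z.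
by rewrite psiE ?rmorphN ?mulNr//; exact: hO.
Qed.

Lemma canonical_base_imag {R : realType} {phi : R -> R[i] -> R[i]}
    {Omega : set R[i]} {h : R[i] -> R[i]} {psi : R -> R[i] -> R[i]} (a : R) (w : R[i]) :
  canonical_model phi Omega h psi ->
  Omega w -> Omega (w + a%:C * 'i%C).
Proof.
move=> -[[_ _ [psiA _ _ _] _ _] psiE _ _ _] Ow.
by rewrite -psiE//; case: (psiA a) => _ psiO _; exact: psiO.
Qed.

(** A constant may be added to h as soon as it preserves the base space: the
maps psi t are translations and so commute with it. *)
Lemma canonical_translate {R : realType} {phi : R -> R[i] -> R[i]}
    {Omega : set R[i]} {h : R[i] -> R[i]} {psi : R -> R[i] -> R[i]}
    {htilde : R[i] -> R[i]} {c : R[i]} :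
  canonical_model phi Omega h psi ->
  semigroup phi -> holomorphic_on disc htilde ->
  (forall z, disc z -> htilde z = h z + c) ->
  (forall w, Omega w -> Omega (w + c)) ->
  (forall w, Omega w -> Omega (w - c)) ->
  canonical_model phi Omega htilde psi.
Proof.
move=> model [phiD _ _ _] hh hE OD OB; have := model.
move=> -[[Ooc [[_ hinj] hO] psiG _ _] psiE Ohyp Opar Ozero].
have htO : set_fun disc Omega htilde by move=> z Dz; rewrite hE//; apply/OD/hO.
split=> //; split=> //.
- split=> //; split=> // x y; rewrite !inE => Dx Dy; rewrite !hE//.
  by move/addIr; apply: hinj; rewrite inE.
- move=> t z t0 Dz; have [_ phiDt] := phiD t t0.
  rewrite psiE; last exact: htO.
  by rewrite !hE//; [rewrite (canonical_abel model)// addrAC | exact: phiDt].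
- apply/seteqP; split=> w.
    move=> [t _ [_ [z Dz <-] <-]]; case: psiG => /(_ (- t))[_ psiO _] _ _ _.
    by apply: psiO; exact: htO.
  move=> /OB /(canonical_baseP model)[t [z [t0 Dz wE]]].
  exists t; first by rewrite /= in_itv /= andbT.
  exists (htilde z); first by exists z.
  rewrite psiE; last exact: htO.
  by rewrite hE// rmorphN mulNr addrAC -wE subrK.
Qed.

(** The base space is a function of the Koenigs map, see [canonical_baseP], that
commutes with translations of the plane. *)
Lemma canonical_base_translate {R : realType} {phi : R -> R[i] -> R[i]}
    {Omega Omega' : set R[i]} {h h' : R[i] -> R[i]}
    {psi psi' : R -> R[i] -> R[i]} {c : R[i]} :
  canonical_model phi Omega h psi -> canonical_model phi Omega' h' psi' ->
  (forall z, disc z -> h' z = h z + c) ->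
  forall w, Omega' (w + c) <-> Omega w.
Proof.
move=> m m' hE w; rewrite (canonical_baseP m) (canonical_baseP m').
split=> -[t [z [t0 Dz wE]]]; exists t, z; split=> //.
  by apply: (addIr c); rewrite wE hE// addrAC.
by rewrite wE hE// addrAC.
Qed.

(** The points [0] and [- c] rule out a nonzero [Re c] of modulus below [rho],
the midpoint of the strip a modulus at least [rho / 2]. *)
Lemma strip_translate {R : realType} {rho : R} {c : R[i]} : 0 < rho ->
  (forall w, strip rho (w + c) <-> strip rho w) -> complex.Re c = 0.
Proof.
move=> rho0 H; case: c H => r i H /=.
have [H0 _] := H 0; have [_ HN] := H (- (r +i* i)).
have [_ Hm] := H (rho / 2)%:C.
rewrite /strip /= ?add0r ?addNr /= in H0 HN Hm.
have half : 0 < rho / 2 < rho by lra.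
have {}Hm := Hm half.
have [r0|r0|//] := ltgtP r 0.
  have /HN : 0 < - r < rho by lra.
  by rewrite ltxx.
have /H0 : 0 < r < rho by lra.
by rewrite ltxx.
Qed.

Lemma right_half_plane_translate {R : realType} {c : R[i]} :
  (forall w, right_half_plane (w + c) <-> right_half_plane w) ->
  complex.Re c = 0.
Proof.
move=> H; case: c H => r i H /=.
have [H0 _] := H 0; have [_ HN] := H (- (r +i* i)).
rewrite /right_half_plane /= ?add0r ?addNr /= in H0 HN.
have [r0|r0|//] := ltgtP r 0.
  have : 0 < - r by lra.
  by move/HN; rewrite ltxx.
by move/H0: r0; rewrite ltxx.
Qed.

Lemma left_half_plane_translate {R : realType} {c : R[i]} :
  (forall w, left_half_plane (w + c) <-> left_half_plane w) ->
  complex.Re c = 0.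
Proof.
move=> H; case: c H => r i H /=.
have [H0 _] := H 0; have [_ HN] := H (- (r +i* i)).
rewrite /left_half_plane /= ?add0r ?addNr /= in H0 HN.
have [r0|r0|//] := ltgtP r 0.
  by move/H0: r0; rewrite ltxx.
have : - r < 0 by lra.
by move/HN; rewrite ltxx.
Qed.

(** * Classification of the Koenigs functions *)

Theorem proposition4p2 (R : realType) (phi : R -> R[i] -> R[i])
    (Omega : set R[i]) (h : R[i] -> R[i]) (psi : R -> R[i] -> R[i])
    (htilde : R[i] -> R[i])
    (phi_semigroup : semigroup phi) (phi_nonelliptic : ~ elliptic phi)
    (model : canonical_model phi Omega h psi)
    (htilde_holo : holomorphic_on disc htilde)
    (htilde_fun : set_fun disc Omega htilde) :
  (hyperbolic phi \/ (parabolic phi /\ positive_hyperbolic_step phi) ->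
    (koenigs_function phi htilde <->
     exists a : R, forall z, disc z -> htilde z = h z + a%:C * 'i%C)) /\
  (parabolic phi /\ zero_hyperbolic_step phi ->
    (koenigs_function phi htilde <->
     exists a : R[i], forall z, disc z -> htilde z = h z + a)).
Proof.
have h_holo : holomorphic_on disc h by case: model => -[_ [[]]].
have D0 : disc (0 : R[i]) by rewrite /disc /= expr0n /= addr0 sqrtr0 ltr01.
have translation Omega' psi' : canonical_model phi Omega' htilde psi' ->
    forall z, disc z -> htilde z = h z + (htilde 0 - h 0).
  move=> m'; exact: (abel_equation_unique phi_semigroup h_holo htilde_holo
    (canonical_abel model) (canonical_abel m')).
split; [move=> kind|move=> [par zero]]; split.
- move=> [Om' [psi' m']]; have hE := translation _ _ m'.
  set c := htilde 0 - h 0 in hE.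
  have OO' := canonical_base_translate model m' hE.
  have [_ _ hyp pos _] := model; have [[_ [_ htO'] _ _ _] _ hyp' pos' _] := m'.
  suff c0 : complex.Re c = 0.
    exists (complex.Im c) => z Dz; rewrite hE//; congr (_ + _).
    by rewrite [LHS]complexE c0 add0r mulrC.
  have [hphi|[par ps]] := kind.
    have [_ [lambda l0 sl]] := hphi.
    rewrite (hyp _ hphi sl) (hyp' _ hphi sl) in OO'.
    by apply: strip_translate OO'; rewrite divr_gt0// pi_gt0.
  (* The point htilde 0 lies in both base spaces, so these are the same
     half-plane. *)
  have hO := htilde_fun 0 D0; have hO' := htO' 0 D0.
  case: (pos par ps) (pos' par ps) => O [] O'; rewrite ?O ?O' /= in OO' hO hO'.
  + exact: right_half_plane_translate OO'.
  + by have := lt_trans hO hO'; rewrite ltxx.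
  + by have := lt_trans hO hO'; rewrite ltxx.
  + exact: left_half_plane_translate OO'.
- move=> [a hE]; exists Omega, psi.
  apply: (canonical_translate model) hE _ _ => // w Ow.
    exact: canonical_base_imag model Ow.
  by rewrite -mulNr -rmorphN; exact: canonical_base_imag model Ow.
- by move=> [Om' [psi' m']]; exists (htilde 0 - h 0); exact: translation m'.
- move=> [a hE]; exists Omega, psi.
  have [_ _ _ _ OT] := model.
  by apply: (canonical_translate model) hE _ _ => // w _; rewrite OT.
Qed.
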